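(* For every integer $n\ge5$ one has $$n+\left[\tfrac{n+1}{2}\right]\le Z(n)\le 2n+\left[\tfrac{n+1}{2}\right],$$ where $Z(n)$ is the maximal number of zeros in the open interval $(0,1)$ of the function $$\bar M(h)=\int_{\widehat{AA_1}}\big(q^{+}\,dx-p^{+}\,dy\big)+\int_{\widehat{A_1A}}\big(q^{-}\,dx-p^{-}\,dy\big),\qquad 0<h<1,$$ the maximum being taken over all real polynomials $p^{\pm}(x,y),q^{\pm}(x,y)$ of degree at most $n$ for which $\bar M$ is not identically zero on $(0,1)$.
   Context: $[\cdot]$ denotes the integer part. For $0<h<1$ put $A=(0,-\sqrt{1-h})$ and $A_1=(0,\sqrt{1-h})$. The arc $\widehat{AA_1}$ is the curve $x=1-\sqrt{h+y^2}$, $|y|\le\sqrt{1-h}$, traversed from $A$ to $A_1$; it is the orbit arc on $\frac12((x-1)^2-y^2)=\frac h2$, $x\ge0$. The arc $\widehat{A_1A}$ is the half circle $x^2+y^2=1-h$, $x\le 0$, traversed anticlockwise from $A_1$ to $A$. The function $\bar M$ is the first order Melnikov function of the piecewise system $\dot x=-y+\varepsilon p^+,\ \dot y=1-x+\varepsilon q^+$ for $x\ge0$; $\dot x=-y+\varepsilon p^-,\ \dot y=x+\varepsilon q^-$ for $x<0$. *)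

(* Defs.v *)
From Stdlib Require Import Reals List.
From Coquelicot Require Import Coquelicot.
Open Scope R_scope.

Definition poly2_deg_le (n : nat) (f : R -> R -> R) : Prop :=
  exists c : nat -> nat -> R, forall x y : R,
    f x y = sum_f_R0 (fun i =>
              sum_f_R0 (fun j => c i j * x ^ i * y ^ j) (n - i)) n.

(* The integral of P dx + Q dy along t |-> (X t, Y t), t from a to b. *)
Definition line_integral (P Q : R -> R -> R) (X Y : R -> R) (a b : R) : R :=
  RInt (fun t => P (X t) (Y t) * Derive X t + Q (X t) (Y t) * Derive Y t) a b.

(* The first arc is parametrized by y, from A = (0, - sqrt (1 - h)) to
   A1 = (0, sqrt (1 - h)); the second one by the polar angle, which runs from
   PI / 2 (at A1) to 3 PI / 2 (at A). *)
Definition Mbar (pp qp pm qm : R -> R -> R) (h : R) : R :=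
  line_integral qp (fun x y => - pp x y)
    (fun y => 1 - sqrt (h + y ^ 2)) (fun y => y)
    (- sqrt (1 - h)) (sqrt (1 - h))
  + line_integral qm (fun x y => - pm x y)
    (fun t => sqrt (1 - h) * cos t) (fun t => sqrt (1 - h) * sin t)
    (PI / 2) (3 * PI / 2).

(* Zeros are counted without multiplicity. *)
Definition num_zeros01 (f : R -> R) (k : nat) : Prop :=
  exists l : list R,
    NoDup l /\ length l = k /\
    (forall h : R, In h l <-> (0 < h < 1 /\ f h = 0)).

Definition admissible (n : nat) (M : R -> R) : Prop :=
  (exists pp qp pm qm : R -> R -> R,
    poly2_deg_le n pp /\ poly2_deg_le n qp /\
    poly2_deg_le n pm /\ poly2_deg_le n qm /\
    M = Mbar pp qp pm qm) /\
  ~ (forall h : R, 0 < h < 1 -> M h = 0).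

(* The second clause includes the finiteness of every zero set involved. *)
Definition is_max_num_zeros (n Z : nat) : Prop :=
  (exists M : R -> R, admissible n M /\ num_zeros01 M Z) /\
  (forall M : R -> R, admissible n M ->
     exists k : nat, num_zeros01 M k /\ (k <= Z)%nat).

(* Main.v *)
Require Import Defs.
From Stdlib Require Import Reals List FinFun Lra Lia Classical FunctionalExtensionality.
From Coquelicot Require Import Coquelicot.
Open Scope R_scope.

(** With [a = sqrt (1 - h)] and [L = ln ((1 + a) / (1 - a))], integration along
    the two arcs gives [Mbar h = P a + Q a * L] for polynomials [P], [Q] of
    degree at most [n + 1].  In the variable [t = L] one has
    [a = (e^t - 1) / (e^t + 1)], so [(e^t + 1)^(n+1) Mbar] has the form
    [A (e^t) + t B (e^t)] and, by Rolle's theorem, at most [2 (n + 2) - 1] zeros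
    unless it vanishes; for [n >= 5] this is at most [2 n + [(n + 1) / 2]].
    Conversely [p- = x^d] yields [a^(d+1)] for [d <= n], and
    [p+ = (1 - x) y^(2k)] yields a polynomial plus a nonzero multiple of
    [h^(k+1) L] for [2 k + 1 <= n].  These [n + 1 + [(n + 1) / 2]] functions are
    linearly independent, so a nontrivial combination vanishes at any
    [n + [(n + 1) / 2]] prescribed points. *)

(** * Polynomials and the function [L] *)

(** The variable [t] is chosen because differentiating the logarithm in [a] brings in denominators
    [1 - a^2], whereas in [t] the logarithm is the variable itself and every derivative stays an
    exponential polynomial. A pair [P], [Q] with [m] coefficients each then has at most [2 m - 1]
    zeros, one less than the number of coefficients. The degree bound [n + 1] rests on two
    reductions on the orbit arc: the orbit equation lowers the power of [x], and integration by
    parts turns [dx] into [dy]. Linear independence is never tested on coefficients of a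
    combination. The realizable functions are filtered by degree, each inclusion is shown to be
    strict, and each prescribed zero costs at most one step of the filtration. *)

(** A polynomial is a function with a Horner form of [m] coefficients. Bounding the degree strictly
    makes [m = 0] the zero function, so inductions that peel off the constant coefficient start at a
    trivial case. *)
Fixpoint poly_lt (m : nat) (f : R -> R) : Prop :=
  match m with
  | O => forall x, f x = 0
  | S m => exists c g, poly_lt m g /\ forall x, f x = c + x * g x
  end.

Lemma poly_lt_ext m f g :
  poly_lt m f -> (forall x, g x = f x) -> poly_lt m g.
Proof.
  destruct m as [|m]; simpl.
  - intros Hf E x. now rewrite E.
  - intros (c & f1 & Hf1 & Ef) E. exists c, f1. split; [exact Hf1|].
    intros x. now rewrite E.
Qed.

Lemma poly_lt_0 m : poly_lt m (fun _ => 0).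
Proof.
  induction m as [|m IH]; simpl; [reflexivity|].
  exists 0, (fun _ => 0). split; [exact IH|]. intros x; ring.
Qed.

Lemma poly_lt_const m c : poly_lt (S m) (fun _ => c).
Proof.
  exists c, (fun _ => 0). split; [apply poly_lt_0|]. intros x; ring.
Qed.

Lemma poly_lt_S m f : poly_lt m f -> poly_lt (S m) f.
Proof.
  revert f. induction m as [|m IH]; intros f Hf.
  - exists 0, (fun _ => 0). split; [exact (poly_lt_0 0)|].
    intros x. rewrite (Hf x). ring.
  - destruct Hf as (c & g & Hg & Ef). exists c, g. split; [now apply IH|exact Ef].
Qed.

Lemma poly_lt_weaken m m' f : (m <= m')%nat -> poly_lt m f -> poly_lt m' f.
Proof.
  induction 1 as [|m' _ IH]; intros Hf; [exact Hf|]. now apply poly_lt_S, IH.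
Qed.

Lemma poly_lt_lin m f g c :
  poly_lt m f -> poly_lt m g -> poly_lt m (fun x => f x + c * g x).
Proof.
  revert f g. induction m as [|m IH]; intros f g Hf Hg.
  - intros x. rewrite (Hf x), (Hg x). ring.
  - destruct Hf as (a & f1 & Hf1 & Ef), Hg as (b & g1 & Hg1 & Eg).
    exists (a + c * b), (fun x => f1 x + c * g1 x).
    split; [now apply IH|]. intros x. rewrite Ef, Eg. ring.
Qed.

Lemma poly_lt_plus m f g :
  poly_lt m f -> poly_lt m g -> poly_lt m (fun x => f x + g x).
Proof.
  intros Hf Hg. apply (poly_lt_ext m _ _ (poly_lt_lin m f g 1 Hf Hg)).
  intros x; ring.
Qed.

Lemma poly_lt_scal m c f : poly_lt m f -> poly_lt m (fun x => c * f x).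
Proof.
  intros Hf. apply (poly_lt_ext m _ _ (poly_lt_lin m _ f c (poly_lt_0 m) Hf)).
  intros x; ring.
Qed.

Lemma poly_lt_mul_affine m c d f :
  poly_lt m f -> poly_lt (S m) (fun x => (c + d * x) * f x).
Proof.
  intros Hf.
  apply (poly_lt_ext (S m)) with (fun x => c * f x + d * (0 + x * f x)).
  - apply poly_lt_lin.
    + now apply poly_lt_scal, poly_lt_S.
    + exists 0, f. now split.
  - intros x; ring.
Qed.

Lemma poly_lt_affine_pow m c d : poly_lt (S m) (fun x => (c + d * x) ^ m).
Proof.
  induction m as [|m IH]; [exact (poly_lt_const 0 1)|].
  exact (poly_lt_mul_affine (S m) c d _ IH).
Qed.

Lemma poly_lt_pow m : poly_lt (S m) (fun x => x ^ m).
Proof.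
  apply (poly_lt_ext _ _ _ (poly_lt_affine_pow m 0 1)). intros x.
  f_equal; ring.
Qed.

Lemma poly_lt_mul_1_minus_sqr m f :
  poly_lt m f -> poly_lt (S (S m)) (fun x => (1 - x ^ 2) * f x).
Proof.
  intros Hf.
  apply (poly_lt_ext _ _ _
           (poly_lt_mul_affine _ 1 1 _ (poly_lt_mul_affine _ 1 (-1) _ Hf))).
  intros x; ring.
Qed.

Lemma poly_lt_comp_affine m c d f :
  poly_lt m f -> poly_lt m (fun x => f (c + d * x)).
Proof.
  revert f. induction m as [|m IH]; intros f Hf.
  - intros x. apply Hf.
  - destruct Hf as (a & g & Hg & Ef).
    apply (poly_lt_ext (S m)) with (fun x => a + (c + d * x) * g (c + d * x)).
    + apply poly_lt_plus; [apply poly_lt_const|].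
      apply (poly_lt_mul_affine m c d _ (IH _ Hg)).
    + intros x. apply Ef.
Qed.

Lemma poly_lt_comp_1_minus_sqr m f :
  poly_lt m f -> poly_lt (2 * m) (fun x => f (1 - x ^ 2)).
Proof.
  revert f. induction m as [|m IH]; intros f Hf.
  - intros x. apply Hf.
  - destruct Hf as (a & g & Hg & Ef).
    replace (2 * S m)%nat with (S (S (2 * m))) by lia.
    apply (poly_lt_ext (S (S (2 * m))))
      with (fun x => a + (1 - x ^ 2) * g (1 - x ^ 2)).
    + apply poly_lt_plus; [apply poly_lt_const|].
      apply (poly_lt_mul_1_minus_sqr _ _ (IH _ Hg)).
    + intros x. apply Ef.
Qed.

Lemma poly_lt_bounded m f :
  poly_lt m f -> exists C, 0 <= C /\ forall x, 0 <= x <= 1 -> Rabs (f x) <= C.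
Proof.
  revert f. induction m as [|m IH]; intros f Hf.
  - exists 0. split; [lra|]. intros x _. rewrite (Hf x), Rabs_R0. lra.
  - destruct Hf as (c & g & Hg & Ef), (IH g Hg) as (C & HC & HgC).
    exists (Rabs c + C). pose proof (Rabs_pos c). split; [lra|].
    intros x Hx. rewrite Ef.
    eapply Rle_trans; [apply Rabs_triang|]. rewrite Rabs_mult, (Rabs_pos_eq x) by lra.
    specialize (HgC x Hx). pose proof (Rabs_pos (g x)). nra.
Qed.

(** Replaces a limit at 0. For [c <> 0] the bound at [1/2] forces [K >= 2 |c| > 0], so [|c| / (4 K)]
    lies in the interval, and there the bound reads [|c| <= |c| / 4]. *)
Lemma Rabs_le_linear_eq_0 c K :
  (forall x, 0 < x < 1 -> Rabs c <= K * x) -> c = 0.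
Proof.
  intros H. destruct (Req_dec c 0) as [E|E]; [exact E|exfalso].
  pose proof (Rabs_pos_lt c E) as Hc.
  assert (H2 := H (1/2) ltac:(lra)).
  assert (0 < Rabs c / (4 * K)) by (apply Rdiv_lt_0_compat; lra).
  assert (Rabs c / (4 * K) < 1).
  { apply (Rmult_lt_reg_r (4 * K)); [lra|]. field_simplify; lra. }
  specialize (H (Rabs c / (4 * K)) ltac:(lra)).
  replace (K * (Rabs c / (4 * K))) with (Rabs c / 4) in H by (field; lra). lra.
Qed.

(** The constant coefficient of [f] is [O(x)] and hence 0; dividing by [x] lowers [m]. This makes
    the degree filtrations strict. *)
Lemma poly_lt_eq_monomial m f c :
  poly_lt m f -> (forall x, 0 < x < 1 -> c * x ^ m = f x) -> c = 0.
Proof.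
  revert f. induction m as [|m IH]; intros f Hf H.
  - specialize (H (1/2) ltac:(lra)). rewrite (Hf (1/2)) in H. simpl in H. lra.
  - destruct Hf as (b & g & Hg & Ef).
    assert (Hb : b = 0).
    { destruct (poly_lt_bounded m g Hg) as (C & HC & HgC).
      apply (Rabs_le_linear_eq_0 b (Rabs c + C)). intros x Hx.
      assert (E : b = x * (c * x ^ m - g x)).
      { specialize (H x Hx). rewrite Ef in H. simpl in H. lra. }
      rewrite E at 1. rewrite Rabs_mult, (Rabs_pos_eq x) by lra.
      rewrite Rmult_comm. apply Rmult_le_compat_r; [lra|].
      eapply Rle_trans; [apply Rabs_triang|]. rewrite Rabs_Ropp, Rabs_mult.
      apply Rplus_le_compat; [|apply HgC; lra].
      assert (Hp : 0 <= x ^ m <= 1).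
      { split; [apply pow_le; lra|].
        rewrite <- (pow1 m). apply pow_incr; lra. }
      rewrite (Rabs_pos_eq (x ^ m)) by lra. pose proof (Rabs_pos c). nra. }
    apply (IH g Hg). intros x Hx. specialize (H x Hx). rewrite Ef, Hb in H.
    simpl in H. apply (Rmult_eq_reg_l x); lra.
Qed.

(** * The substitution a = tanh (t / 2) and its inverse [logq] *)

Definition tanh2 (t : R) : R := (exp t - 1) / (exp t + 1).

Lemma tanh2_bounds t : 0 < t -> 0 < tanh2 t < 1.
Proof.
  intros Ht. pose proof (exp_ineq1 t ltac:(lra)).
  unfold tanh2. split.
  - apply Rdiv_lt_0_compat; lra.
  - apply (Rmult_lt_reg_r (exp t + 1)); [lra|]. field_simplify; lra.
Qed.

Definition logq (a : R) : R := ln ((1 + a) / (1 - a)).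

Lemma logq_tanh2 t : logq (tanh2 t) = t.
Proof.
  unfold logq, tanh2. pose proof (exp_pos t).
  replace ((1 + _) / _) with (exp t) by (field; lra). apply ln_exp.
Qed.

Lemma tanh2_logq a : 0 < a < 1 -> tanh2 (logq a) = a.
Proof.
  intros Ha. unfold logq, tanh2. rewrite exp_ln.
  - field. lra.
  - apply Rdiv_lt_0_compat; lra.
Qed.

Lemma logq_pos a : 0 < a < 1 -> 0 < logq a.
Proof.
  intros Ha. unfold logq. rewrite <- ln_1. apply ln_increasing; [lra|].
  apply (Rmult_lt_reg_r (1 - a)); [lra|]. field_simplify; lra.
Qed.

(** Quadratic growth is just what is needed for [(1 - tanh2 t) * t ^ 2 <= 8], since
    [1 - tanh2 t = 2 / (exp t + 1)]. *)
Lemma exp_ge_sqr t : 0 <= t -> t ^ 2 / 4 <= exp t.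
Proof.
  intros Ht. replace t with (t / 2 + t / 2) at 2 by field. rewrite exp_plus.
  destruct (Req_dec t 0) as [->|Ht0].
  - pose proof (exp_pos (0 / 2)). nra.
  - pose proof (exp_ineq1 (t / 2) ltac:(lra)). nra.
Qed.

(* As [a -> 1] one has [logq a -> +oo] and [(1 - a) * logq a -> 0], so the
   coefficients in powers of [1 - a] are peeled off one by one. *)
Lemma poly_logq_independent m P Q :
  poly_lt m P -> poly_lt m Q ->
  (forall a, 0 < a < 1 -> P a + Q a * logq a = 0) -> forall x, Q x = 0.
Proof.
  intros HP HQ H.
  (* Restated in powers of [1 - a], so that the coefficients to be peeled off are the Horner
     coefficients at 0. *)
  assert (G : forall k p q, poly_lt k p -> poly_lt k q ->
    (forall a, 0 < a < 1 -> p (1 - a) + q (1 - a) * logq a = 0) ->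
    forall x, q x = 0).
  { clear. induction k as [|k IH]; intros p q Hp Hq H; [exact Hq|].
    destruct Hp as (c & p1 & Hp1 & Ep), Hq as (d & q1 & Hq1 & Eq).
    destruct (poly_lt_bounded k p1 Hp1) as (C & HC & HpC).
    destruct (poly_lt_bounded k q1 Hq1) as (D & HD & HqD).
    (* Here [b] is [1 - a] at [a = tanh2 t], where the logarithm equals [t]; [u] and [v] are the
       bounded values of the remainders [p1] and [q1]. *)
    assert (E : forall t, 0 < t -> exists b u v,
      Rabs u <= C /\ Rabs v <= D /\ 0 < b < 1 /\ b * t ^ 2 <= 8 /\
      c + b * u + (d + b * v) * t = 0).
    { intros t Ht. pose proof (tanh2_bounds t Ht) as Hb.
      exists (1 - tanh2 t), (p1 (1 - tanh2 t)), (q1 (1 - tanh2 t)).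
      split; [apply HpC; lra|]. split; [apply HqD; lra|].
      split; [lra|]. split.
      - unfold tanh2. pose proof (exp_pos t). pose proof (exp_ge_sqr t ltac:(lra)).
        apply (Rmult_le_reg_r (exp t + 1)); [lra|]. field_simplify; lra.
      - specialize (H (tanh2 t) Hb). rewrite Ep, Eq, logq_tanh2 in H. exact H. }
    assert (Hd : d = 0).
    (* With [t = 1 / x], dividing the relation by [t] isolates [d]; all other terms are [O(x)]
       because [b <= 8 * x]. *)
    { apply (Rabs_le_linear_eq_0 d (Rabs c + C + 8 * D)). intros x Hx.
      assert (Ht : 1 < / x) by (rewrite <- Rinv_1; apply Rinv_lt_contravar; lra).
      destruct (E (/ x) ltac:(lra)) as (b & u & v & Hu & Hv & Hb & Hbt & Eq0).
      assert (Ed : d = - (c * x + b * u * x + b * v)).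
      { apply (Rmult_eq_reg_r (/ x)); [|lra]. field_simplify; [|lra|lra].
        apply (f_equal (fun z => z * x)) in Eq0. field_simplify in Eq0; [|lra].
        field_simplify_eq; lra. }
      assert (Hbx : b <= 8 * x).
      { apply (Rmult_le_reg_r ((/ x) ^ 2)); [nra|].
        apply Rle_trans with 8; [exact Hbt|].
        replace (8 * x * (/ x) ^ 2) with (8 * / x) by (field; lra). lra. }
      rewrite Ed, Rabs_Ropp.
      eapply Rle_trans; [apply Rabs_triang|].
      eapply Rle_trans; [apply Rplus_le_compat_r, Rabs_triang|].
      rewrite !Rabs_mult, (Rabs_pos_eq x), (Rabs_pos_eq b) by lra.
      pose proof (Rabs_pos u). pose proof (Rabs_pos v). pose proof (Rabs_pos c).
      assert (b * Rabs u * x <= C * x) by (apply Rmult_le_compat_r; nra).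
      assert (b * Rabs v <= (8 * x) * D) by (apply Rmult_le_compat; lra).
      lra. }
    assert (Hc : c = 0).
    (* Now [d = 0], and [c] is bounded by multiples of [b] and [b * t], both at most [8 * x]. *)
    { apply (Rabs_le_linear_eq_0 c (8 * C + 8 * D)). intros x Hx.
      assert (Ht : 1 < / x) by (rewrite <- Rinv_1; apply Rinv_lt_contravar; lra).
      destruct (E (/ x) ltac:(lra)) as (b & u & v & Hu & Hv & Hb & Hbt & Eq0).
      assert (Ed : c = - (b * u + b * / x * v)) by (rewrite Hd in Eq0; lra).
      assert (Hbx : b * / x <= 8 * x).
      { apply (Rmult_le_reg_r (/ x)); [lra|].
        replace (8 * x * / x) with 8 by (field; lra). lra. }
      rewrite Ed, Rabs_Ropp.
      eapply Rle_trans; [apply Rabs_triang|].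
      rewrite !Rabs_mult, (Rabs_pos_eq (/ x)), (Rabs_pos_eq b) by lra.
      pose proof (Rabs_pos u). pose proof (Rabs_pos v).
      assert (b <= b * / x) by nra.
      assert (b * Rabs u <= (8 * x) * C) by (apply Rmult_le_compat; lra).
      assert (b * / x * Rabs v <= (8 * x) * D) by (apply Rmult_le_compat; nra).
      lra. }
    assert (Z : forall x, q1 x = 0).
    { apply (IH p1 q1 Hp1 Hq1). intros a Ha. specialize (H a Ha).
      rewrite Ep, Eq, Hc, Hd in H. apply (Rmult_eq_reg_l (1 - a)); lra. }
    intros x. rewrite Eq, Z, Hd. ring. }
  intros x.
  assert (Z := G m (fun x => P (1 + -1 * x)) (fun x => Q (1 + -1 * x))
    (poly_lt_comp_affine m 1 (-1) P HP) (poly_lt_comp_affine m 1 (-1) Q HQ)).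
  replace x with (1 + -1 * (1 - x)) by ring. apply Z.
  intros a Ha. replace (1 + -1 * (1 - a)) with a by ring. now apply H.
Qed.

(** * Counting zeros *)

(** An increasing chain of [k] zeros beyond [x]. The ordering is built in because Rolle's theorem
    acts on consecutive zeros. *)
Fixpoint zeros_after (k : nat) (x : R) (f : R -> R) : Prop :=
  match k with
  | O => True
  | S k => exists y, x < y /\ f y = 0 /\ zeros_after k y f
  end.

Lemma zeros_after_lower k x x' f :
  x' <= x -> zeros_after k x f -> zeros_after k x' f.
Proof.
  destruct k as [|k]; simpl; [trivial|].
  intros Hx (y & Hy & H). exists y. split; [lra|exact H].
Qed.

Lemma zeros_after_impl k x f g :
  (forall t, f t = 0 -> g t = 0) -> zeros_after k x f -> zeros_after k x g.
Proof.
  intros E. revert x. induction k as [|k IH]; intros x; simpl; [trivial|].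
  intros (y & Hy & Hf & H). exists y. auto.
Qed.

Lemma zeros_after_derive k x f f' :
  (forall t, is_derive f t (f' t)) ->
  zeros_after (S k) x f -> zeros_after k x f'.
Proof.
  intros Hd (y & Hxy & Hy & H). apply zeros_after_lower with y; [lra|].
  (* The starting point is now itself a zero of [f], so each step of the chain has a zero at both
     ends. *)
  clear x Hxy. revert y Hy H. induction k as [|k IH]; intros y Hy H; [exact I|].
  destruct H as (z & Hyz & Hz & H).
  destruct (MVT_cor2 f f' y z Hyz) as (c & E & Hc).
  { intros t _. apply is_derive_Reals, Hd. }
  exists c. split; [lra|]. split.
  - rewrite Hy, Hz in E. nra.
  - apply zeros_after_lower with z; [lra|]. now apply IH.
Qed.

Lemma derive_zero_zeros_after k x f f' :
  (forall t, is_derive f t (f' t)) -> (forall t, f' t = 0) ->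
  zeros_after (S k) x f -> forall t, f t = 0.
Proof.
  intros Hd Z (y & _ & Hy & _) t.
  assert (E : forall u v, u < v -> f u = f v).
  { intros u v. apply eq_is_derive. intros s _. replace zero with (f' s) by apply Z. apply Hd. }
  destruct (Rtotal_order t y) as [H|[->|H]].
  - now rewrite (E _ _ H).
  - exact Hy.
  - now rewrite <- (E _ _ H).
Qed.

Lemma poly_lt_mul_x m f : poly_lt (pred m) f -> poly_lt m (fun x => x * f x).
Proof.
  destruct m as [|m]; intros Hf.
  - intros x. rewrite (Hf x). ring.
  - exists 0, f. split; [exact Hf|]. intros x; ring.
Qed.

(** [A'] is the derivative of the polynomial [A], built along the Horner form by
    [(c + x g)' = g + x g']. The drop from [m] to [pred m] drives the induction on zeros. *)
Lemma poly_exp_derive m A :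
  poly_lt m A -> exists A', poly_lt (pred m) A' /\
    forall t, is_derive (fun t => A (exp t)) t (exp t * A' (exp t)).
Proof.
  revert A. induction m as [|m IH]; intros A HA.
  - exists (fun _ => 0). split; [exact (poly_lt_0 0)|]. intros t.
    apply is_derive_ext with (fun _ => 0).
    + intros s. symmetry. apply HA.
    + cbv beta. rewrite Rmult_0_r. exact (is_derive_const 0 t).
  - destruct HA as (c & g & Hg & E), (IH g Hg) as (g' & Hg' & Dg).
    exists (fun x => g x + x * g' x). split.
    + apply poly_lt_plus; [exact Hg|]. now apply poly_lt_mul_x.
    + intros t. apply is_derive_ext with (fun s => c + exp s * g (exp s)).
      { intros s. now rewrite E. }
      replace (exp t * _) with
        (0 + (exp t * g (exp t) + exp t * (exp t * g' (exp t)))) by ring.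
      apply (is_derive_plus (fun _ => c) (fun s => exp s * g (exp s))).
      * exact (is_derive_const c t).
      * apply (is_derive_mult exp (fun s => g (exp s))).
        -- apply is_derive_Reals, derivable_pt_lim_exp.
        -- apply Dg.
        -- intros; apply Rmult_comm.
Qed.

(* The second derivative kills the terms [a + b t] and leaves [exp t] times an
   expression of the same shape and lower degree, so Rolle's theorem applies. *)
Lemma poly_exp_zeros m x A B :
  poly_lt m A -> poly_lt m B ->
  zeros_after (2 * m) x (fun t => A (exp t) + t * B (exp t)) ->
  forall t, A (exp t) + t * B (exp t) = 0.
Proof.
  revert x A B. induction m as [|m IH]; intros x A B HA HB Hz.
  - intros t. rewrite (HA (exp t)), (HB (exp t)). ring.
  - replace (2 * S m)%nat with (S (S (2 * m))) in Hz by lia.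
    destruct (poly_exp_derive (S m) A HA) as (A1 & HA1 & DA).
    destruct (poly_exp_derive (S m) B HB) as (B1 & HB1 & DB).
    destruct (poly_exp_derive m A1 HA1) as (A2 & HA2 & DA1).
    destruct (poly_exp_derive m B1 HB1) as (B2 & HB2 & DB1).
    assert (Dexp : forall t, is_derive exp t (exp t)).
    { intros t. apply is_derive_Reals, derivable_pt_lim_exp. }
    assert (Mul : forall f g f' g' t, is_derive f t f' -> is_derive g t g' ->
              is_derive (fun s => f s * g s) t (f' * g t + f t * g')).
    { intros. apply (is_derive_mult f g); auto. intros; apply Rmult_comm. }
    pose (f1 := fun t => exp t * A1 (exp t) + (B (exp t) + t * (exp t * B1 (exp t)))).
    assert (D1 : forall t, is_derive (fun t => A (exp t) + t * B (exp t)) t (f1 t)).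
    { intros t. apply (is_derive_plus (fun t => A (exp t)) (fun t => t * B (exp t))).
      - apply DA.
      - replace (_ + _) with (1 * B (exp t) + t * (exp t * B1 (exp t))) by ring.
        apply (Mul (fun t => t) (fun t => B (exp t))); [exact (is_derive_id t)|apply DB]. }
    (* The second derivative divided by [exp t]; the coefficient 2 collects the terms [B1] from both
       differentiations of the product with [t]. *)
    pose (g := fun t => (A1 (exp t) + exp t * A2 (exp t) + 2 * B1 (exp t))
                        + t * (B1 (exp t) + exp t * B2 (exp t))).
    assert (D2 : forall t, is_derive f1 t (exp t * g t)).
    { intros t. unfold f1, g.
      match goal with |- is_derive _ _ ?d => replace d with
        ((exp t * A1 (exp t) + exp t * (exp t * A2 (exp t)))
         + (exp t * B1 (exp t)
            + (1 * (exp t * B1 (exp t))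
               + t * (exp t * B1 (exp t) + exp t * (exp t * B2 (exp t))))))
        by ring end.
      apply (is_derive_plus (fun t => exp t * A1 (exp t))
               (fun t => B (exp t) + t * (exp t * B1 (exp t)))).
      - apply (Mul exp (fun t => A1 (exp t)) _ _ _ (Dexp t) (DA1 t)).
      - apply (is_derive_plus (fun t => B (exp t)) (fun t => t * (exp t * B1 (exp t)))).
        + apply DB.
        + apply (Mul (fun t => t) (fun t => exp t * B1 (exp t))).
          * exact (is_derive_id t).
          * apply (Mul exp (fun t => B1 (exp t)) _ _ _ (Dexp t) (DB1 t)). }
    assert (Zg : forall t, g t = 0).
    { apply (IH x (fun w => A1 w + w * A2 w + 2 * B1 w) (fun w => B1 w + w * B2 w)).
      - apply poly_lt_lin; [apply poly_lt_plus|]; auto using poly_lt_mul_x.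
      - apply poly_lt_plus; auto using poly_lt_mul_x.
      - apply zeros_after_impl with (fun t => exp t * g t).
        + intros t Ht. pose proof (exp_pos t). unfold g in Ht |- *. nra.
        + apply zeros_after_derive with f1; [exact D2|].
          now apply zeros_after_derive with (2 := Hz). }
    (* Back up from [g = 0]: the first derivative is constant and has a zero by Rolle, so it
       vanishes; then the function itself is constant with a zero. *)
    apply (derive_zero_zeros_after (S (2 * m)) x _ f1 D1); [|exact Hz].
    apply (derive_zero_zeros_after (2 * m) x _ _ D2).
    + intros t. cbv beta. rewrite Zg. apply Rmult_0_r.
    + now apply zeros_after_derive with (2 := Hz).
Qed.

Lemma list_min (l : list R) :
  l <> nil -> exists m, In m l /\ forall z, In z l -> m <= z.
Proof.
  induction l as [|a l IH]; [congruence|]. intros _.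
  destruct l as [|b l].
  - exists a. split; [now left|]. intros z [->|[]]. lra.
  - destruct IH as (m & Hm & Hmin); [congruence|].
    destruct (Rle_dec a m) as [H|H].
    + exists a. split; [now left|]. intros z [->|Hz]; [lra|].
      specialize (Hmin z Hz). lra.
    + exists m. split; [now right|]. intros z [->|Hz]; [lra|]. now apply Hmin.
Qed.

(** Selection sort: the minimum is removed again and again, and absence of duplicates makes the
    chain strict. *)
Lemma zeros_after_list (l : list R) f x :
  NoDup l -> (forall z, In z l -> x < z /\ f z = 0) -> zeros_after (length l) x f.
Proof.
  remember (length l) as k eqn:Ek. revert l x Ek.
  induction k as [|k IH]; intros l x Ek Hl Hf; [exact I|].
  destruct (list_min l) as (m & Hm & Hmin).
  { intros ->. discriminate. }
  exists m. destruct (Hf m Hm) as [Hxm Hfm]. repeat split; auto.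
  destruct (in_split m l Hm) as (l1 & l2 & ->).
  destruct (NoDup_remove l1 l2 m Hl) as [Hl' Hnm].
  apply (IH (l1 ++ l2)).
  - rewrite length_app in Ek |- *. simpl in Ek. lia.
  - exact Hl'.
  - intros z Hz.
    assert (Hz' : In z (l1 ++ m :: l2)).
    { apply in_or_app. apply in_app_or in Hz. simpl. tauto. }
    split; [|now apply Hf].
    destruct (Hmin z Hz') as [H|<-]; [exact H|contradiction].
Qed.

(** Clears the denominators of [a = (w - 1) / (w + 1)]. For [P = c + a g], multiplying by
    [(w + 1) ^ (m + 1)] gives [c (w + 1) ^ (m + 1)] plus [w - 1] times the homogenized [g]. *)
Lemma poly_lt_homogenize m P :
  poly_lt (S m) P -> exists A, poly_lt (S m) A /\
    forall w, 0 < w -> A w = (w + 1) ^ m * P ((w - 1) / (w + 1)).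
Proof.
  revert P. induction m as [|m IH]; intros P (c & g & Hg & E).
  - exists (fun _ => c). split; [apply poly_lt_const|]. intros w _.
    rewrite E, (Hg ((w - 1) / (w + 1))). simpl. ring.
  - destruct (IH g Hg) as (A & HA & EA).
    exists (fun w => c * (1 + 1 * w) ^ S m + (-1 + 1 * w) * A w). split.
    + apply poly_lt_plus.
      * apply poly_lt_scal, poly_lt_affine_pow.
      * now apply poly_lt_mul_affine.
    + intros w Hw. rewrite E, EA by exact Hw. simpl.
      replace (1 + 1 * w) with (w + 1) by ring. field. lra.
Qed.

Definition log_poly_lt (m : nat) (F : R -> R) : Prop :=
  exists P Q, poly_lt m P /\ poly_lt m Q /\
    forall a, 0 < a < 1 -> F a = P a + Q a * logq a.

Lemma log_poly_zeros m F (l : list R) :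
  log_poly_lt m F -> NoDup l -> (forall a, In a l -> 0 < a < 1 /\ F a = 0) ->
  (2 * m <= length l)%nat -> forall a, 0 < a < 1 -> F a = 0.
Proof.
  intros (P & Q & HP & HQ & E) Hl Hz Hlen.
  destruct m as [|m].
  { intros a Ha. rewrite E, (HP a), (HQ a) by exact Ha. ring. }
  destruct (poly_lt_homogenize m P HP) as (A & HA & EA).
  destruct (poly_lt_homogenize m Q HQ) as (B & HB & EB).
  assert (EF : forall t, 0 < t ->
            A (exp t) + t * B (exp t) = (exp t + 1) ^ m * F (tanh2 t)).
  { intros t Ht. pose proof (tanh2_bounds t Ht). pose proof (exp_pos t).
    rewrite EA, EB, E, logq_tanh2 by assumption. unfold tanh2. ring. }
  assert (Z : forall t, A (exp t) + t * B (exp t) = 0).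
  { apply poly_exp_zeros with (S m) 0; [exact HA|exact HB|].
    assert (Hzs : zeros_after (length (map logq l)) 0
                    (fun t => A (exp t) + t * B (exp t))).
    { apply zeros_after_list.
      - apply (NoDup_map_inv tanh2). rewrite map_map.
        rewrite (map_ext_in _ (fun a => a)), map_id; [exact Hl|].
        intros a Ha. apply tanh2_logq, Hz, Ha.
      - intros t Ht. apply in_map_iff in Ht. destruct Ht as (a & <- & Ha).
        destruct (Hz a Ha) as [Ha01 HFa]. pose proof (logq_pos a Ha01).
        split; [assumption|]. rewrite EF, tanh2_logq, HFa by assumption. ring. }
    (* The list may be longer than needed, so the chain of zeros is truncated to [2 * S m]. *)
    rewrite length_map in Hzs. revert Hlen Hzs. generalize (2 * S m)%nat (length l) 0.
    clear. intros k k' x H. revert k x H. induction k' as [|k' IH]; intros k x H Hz.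
    - now replace k with 0%nat by lia.
    - destruct k as [|k]; [exact I|]. destruct Hz as (y & Hy & Hfy & Hz).
      exists y. repeat split; auto. apply IH; [lia|exact Hz]. }
  intros a Ha. pose proof (logq_pos a Ha) as Ht. specialize (Z (logq a)).
  rewrite EF, tanh2_logq in Z by assumption.
  apply Rmult_integral in Z. destruct Z as [Z|Z]; [exfalso|exact Z].
  revert Z. apply pow_nonzero. pose proof (exp_pos (logq a)). lra.
Qed.

(** Finiteness of the zero set is not known beforehand. Either the zeros can be listed, or there is
    a list of [m + 1] of them to contradict the zero bound. *)
Lemma finite_or_many (T : R -> Prop) (m : nat) :
  (exists l, NoDup l /\ (length l <= m)%nat /\ forall x, In x l <-> T x) \/
  (exists l, NoDup l /\ length l = S m /\ forall x, In x l -> T x).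
Proof.
  induction m as [|m IH].
  - destruct (classic (exists x, T x)) as [[x Hx]|H].
    + right. exists (x :: nil). repeat split.
      * constructor; [intros []|constructor].
      * intros y [<-|[]]. exact Hx.
    + left. exists nil. repeat split; [constructor|simpl; lia|intros []|].
      intros Hx. apply H. now exists x.
  - destruct IH as [(l & Hl & Hlen & E)|(l & Hl & Hlen & E)].
    + left. exists l. repeat split; [exact Hl|lia|apply E|apply E].
    + destruct (classic (exists x, T x /\ ~ In x l)) as [(x & Hx & Hn)|H].
      * right. exists (x :: l). repeat split.
        -- now constructor.
        -- simpl. now rewrite Hlen.
        -- intros y [<-|Hy]; auto.
      * left. exists l. repeat split; [exact Hl|lia|apply E|].
        intros Hx. apply NNPP. intros Hn. apply H. now exists x.
Qed.

(** * Integration along the arcs *)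

Lemma is_RInt_lin (f g : R -> R) (a b If Ig c : R) :
  is_RInt f a b If -> is_RInt g a b Ig ->
  is_RInt (fun y => f y + c * g y) a b (If + c * Ig).
Proof.
  intros Hf Hg. exact (is_RInt_plus _ _ _ _ _ _ Hf (is_RInt_scal _ _ _ c _ Hg)).
Qed.

Lemma is_RInt_eq (f g : R -> R) (a b If Ig : R) :
  is_RInt f a b If -> (forall y : R, g y = f y) -> Ig = If -> is_RInt g a b Ig.
Proof.
  intros Hf E ->. apply is_RInt_ext with (2 := Hf). intros y _. now rewrite E.
Qed.

Lemma is_RInt_FTC (f df : R -> R) (a b : R) :
  (forall y : R, is_derive f y (df y)) -> (forall y : R, ex_derive df y) ->
  is_RInt df a b (f b - f a).
Proof.
  intros Hf Hc. apply (is_RInt_derive f df).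
  - intros y _. apply Hf.
  - intros y _. apply (ex_derive_continuous df), Hc.
Qed.

(** * Moments of the orbit arc, on which [arc_u] is [1 - x] and equals 1 at both ends *)

Definition arc_u (a y : R) : R := sqrt (1 - a ^ 2 + y ^ 2).

Lemma arc_u_arg_pos a y : 0 < a < 1 -> 0 < 1 - a ^ 2 + y ^ 2.
Proof. intros Ha. nra. Qed.

Lemma arc_u_pos a y : 0 < a < 1 -> 0 < arc_u a y.
Proof. intros Ha. apply sqrt_lt_R0, arc_u_arg_pos, Ha. Qed.

Lemma arc_u_sqr a y : 0 < a < 1 -> arc_u a y ^ 2 = 1 - a ^ 2 + y ^ 2.
Proof. intros Ha. apply pow2_sqrt, Rlt_le, arc_u_arg_pos, Ha. Qed.

Lemma arc_u_end a : arc_u a a = 1.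
Proof. transitivity (sqrt 1); [unfold arc_u; f_equal; ring|apply sqrt_1]. Qed.

Lemma arc_u_start a : arc_u a (- a) = 1.
Proof. transitivity (sqrt 1); [unfold arc_u; f_equal; ring|apply sqrt_1]. Qed.

Lemma arc_u_derive a y : 0 < a < 1 -> is_derive (arc_u a) y (y / arc_u a y).
Proof.
  intros Ha. pose proof (arc_u_arg_pos a y Ha) as H. pose proof (arc_u_pos a y Ha).
  unfold arc_u in *. auto_derive; [simpl in H; lra|].
  change (1 - a * (a * 1) + y * (y * 1)) with (1 - a ^ 2 + y ^ 2).
  field. lra.
Qed.

Lemma arc_u_Derive a y : 0 < a < 1 ->
  Derive (fun x : R => arc_u a x) y = y / arc_u a y.
Proof. intros Ha. apply is_derive_unique, arc_u_derive, Ha. Qed.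

Lemma arc_u_ex_derive a y : 0 < a < 1 -> ex_derive (arc_u a) y.
Proof. intros Ha. eexists. now apply arc_u_derive. Qed.

Lemma arc_u_plus_pos a y : 0 < a < 1 -> 0 < y + arc_u a y.
Proof.
  intros Ha. pose proof (arc_u_pos a y Ha). pose proof (arc_u_sqr a y Ha).
  destruct (Rlt_le_dec 0 (y + arc_u a y)) as [H1|H1]; [exact H1|exfalso]. nra.
Qed.

(** The classical antiderivative of [sqrt (c + y^2)]. At the ends [y = a] and [y = - a] the argument
    [y + u] of the logarithm is [1 + a] and [1 - a], whence [logq]. *)
Lemma arc_integral_0 a : 0 < a < 1 ->
  is_RInt (arc_u a) (- a) a (a + (1 - a ^ 2) / 2 * logq a).
Proof.
  intros Ha.
  pose (G := fun y => (y * arc_u a y + (1 - a ^ 2) * ln (y + arc_u a y)) / 2).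
  refine (is_RInt_eq _ _ _ _ _ _ (is_RInt_FTC G (arc_u a) (- a) a _ _) _ _).
  - intros y. pose proof (arc_u_pos a y Ha) as Hu. pose proof (arc_u_sqr a y Ha) as Hs.
    pose proof (arc_u_plus_pos a y Ha) as Hp. pose proof (arc_u_derive a y Ha) as Hd.
    unfold G. auto_derive; [repeat split; auto; now exists (y / arc_u a y)|].
    rewrite (arc_u_Derive a y Ha).
    replace (a * (a * 1)) with (1 + y ^ 2 - arc_u a y ^ 2) by (rewrite Hs; ring).
    field. lra.
  - intros y. now apply arc_u_ex_derive.
  - reflexivity.
  - unfold G. rewrite arc_u_end, arc_u_start. unfold logq.
    rewrite ln_div by lra. rewrite (Rplus_comm a 1), (Rplus_comm (- a) 1).
    unfold Rminus. field.
Qed.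

Lemma arc_integral_1 a : 0 < a < 1 ->
  is_RInt (fun y => arc_u a y * y ^ 1) (- a) a 0.
Proof.
  intros Ha.
  refine (is_RInt_eq _ _ _ _ _ _ (is_RInt_FTC (fun y => arc_u a y ^ 3 / 3)
    (fun y => arc_u a y * y) (- a) a _ _) _ _).
  - intros y. pose proof (arc_u_pos a y Ha) as Hu. pose proof (arc_u_derive a y Ha) as Hd.
    auto_derive; [now exists (y / arc_u a y)|].
    rewrite (arc_u_Derive a y Ha). field. lra.
  - intros y. auto_derive. now apply arc_u_ex_derive.
  - intros y; ring.
  - cbv beta. rewrite arc_u_end, arc_u_start. ring.
Qed.

(** Integrate the derivative of [y ^ (j + 1) * u ^ 3], which is [(j + 1) y^j u^3 + 3 y^(j + 2) u],
    and replace [u ^ 2] by [1 - a ^ 2 + y ^ 2]. The boundary terms are pure powers because [u = 1]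
    there. *)
Lemma arc_integral_step a j I : 0 < a < 1 ->
  is_RInt (fun y => arc_u a y * y ^ j) (- a) a I ->
  is_RInt (fun y => arc_u a y * y ^ (j + 2)) (- a) a
    ((a ^ (j + 1) - (- a) ^ (j + 1) - (INR j + 1) * (1 - a ^ 2) * I) / (INR j + 4)).
Proof.
  intros Ha HI. pose proof (pos_INR j) as Hj.
  pose (df := fun y => (INR j + 1) * (1 - a ^ 2) * (arc_u a y * y ^ j)
                       + (INR j + 4) * (arc_u a y * y ^ (j + 2))).
  assert (H : is_RInt df (- a) a (a ^ (j + 1) - (- a) ^ (j + 1))).
  { refine (is_RInt_eq _ _ _ _ _ _
      (is_RInt_FTC (fun y => y ^ (j + 1) * arc_u a y ^ 3) df (- a) a _ _) _ _).
    - intros y. pose proof (arc_u_pos a y Ha) as Hu.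
      pose proof (arc_u_derive a y Ha) as Hd. pose proof (arc_u_sqr a y Ha) as Hs.
      auto_derive; [repeat split; auto; now exists (y / arc_u a y)|].
      rewrite (arc_u_Derive a y Ha). unfold df.
      replace (1 - a ^ 2) with (arc_u a y ^ 2 - y ^ 2) by (rewrite Hs; ring).
      replace (j + 1)%nat with (S j) by lia. rewrite S_INR, !pow_add.
      simpl. field. lra.
    - intros y. unfold df. auto_derive. repeat split; now apply arc_u_ex_derive.
    - reflexivity.
    - cbv beta. rewrite arc_u_end, arc_u_start. ring. }
  pose proof (is_RInt_scal _ _ _ (/ (INR j + 4)) _
                (is_RInt_lin _ _ _ _ _ _ (- ((INR j + 1) * (1 - a ^ 2))) H HI)) as H2.
  refine (is_RInt_eq _ _ _ _ _ _ H2 _ _).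
  - intros y. unfold df, scal; simpl; unfold mult; simpl. field. lra.
  - unfold scal; simpl; unfold mult; simpl. field. lra.
Qed.

Lemma opp_pow_even a k : (- a) ^ (2 * k) = a ^ (2 * k).
Proof. rewrite !pow_mult. f_equal. ring. Qed.

(** Each recursion step multiplies the logarithmic coefficient by [1 - a ^ 2] and a nonzero number.
    That [c <> 0] is what the lower bound needs. *)
Lemma arc_integral_even k : exists P c, poly_lt (2 * k + 2) P /\ c <> 0 /\
  forall a, 0 < a < 1 ->
  is_RInt (fun y => arc_u a y * y ^ (2 * k)) (- a) a
    (P a + c * (1 - a ^ 2) ^ (k + 1) * logq a).
Proof.
  induction k as [|k (P & c & HP & Hc & H)].
  - exists (fun a => a), (1 / 2). split; [|split; [lra|]].
    + apply (poly_lt_ext _ _ _ (poly_lt_pow 1)). intros; ring.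
    + intros a Ha. refine (is_RInt_eq _ _ _ _ _ _ (arc_integral_0 a Ha) _ _).
      * intros y. simpl. ring.
      * simpl. field.
  - pose proof (pos_INR (2 * k)) as Hk.
    exists (fun a => 2 / (INR (2 * k) + 4) * a ^ (2 * k + 1)
                     + - ((INR (2 * k) + 1) / (INR (2 * k) + 4)) * ((1 - a ^ 2) * P a)),
           (- ((INR (2 * k) + 1) / (INR (2 * k) + 4)) * c).
    split; [|split].
    + apply poly_lt_plus; apply poly_lt_scal.
      * apply poly_lt_weaken with (S (2 * k + 1)); [lia|apply poly_lt_pow].
      * apply poly_lt_weaken with (S (S (2 * k + 2))); [lia|].
        now apply poly_lt_mul_1_minus_sqr.
    + apply Rmult_integral_contrapositive. split; [|exact Hc].
      assert (0 < (INR (2 * k) + 1) / (INR (2 * k) + 4)) by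
        (apply Rdiv_lt_0_compat; lra). lra.
    + intros a Ha.
      refine (is_RInt_eq _ _ _ _ _ _ (arc_integral_step a _ _ Ha (H a Ha)) _ _).
      * intros y. do 2 f_equal. lia.
      * replace (S k + 1)%nat with (S (k + 1)) by lia.
        rewrite (pow_add (- a)), opp_pow_even, pow_add. simpl pow. field. lra.
Qed.

Lemma arc_integral_odd k a : 0 < a < 1 ->
  is_RInt (fun y => arc_u a y * y ^ (2 * k + 1)) (- a) a 0.
Proof.
  intros Ha. induction k as [|k IH]; [exact (arc_integral_1 a Ha)|].
  refine (is_RInt_eq _ _ _ _ _ _ (arc_integral_step a _ _ Ha IH) _ _).
  - intros y. do 2 f_equal. lia.
  - replace (2 * k + 1 + 1)%nat with (2 * (k + 1))%nat by lia.
    rewrite opp_pow_even. pose proof (pos_INR (2 * k + 1)). field. lra.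
Qed.

(** * Integrals of the form P + Q L *)

Lemma log_poly_lt_lin m F G c :
  log_poly_lt m F -> log_poly_lt m G -> log_poly_lt m (fun a => F a + c * G a).
Proof.
  intros (P & Q & HP & HQ & E) (P' & Q' & HP' & HQ' & E').
  exists (fun a => P a + c * P' a), (fun a => Q a + c * Q' a).
  split; [now apply poly_lt_lin|]. split; [now apply poly_lt_lin|].
  intros a Ha. rewrite E, E' by exact Ha. ring.
Qed.

Lemma log_poly_lt_ext m F G :
  log_poly_lt m F -> (forall a, 0 < a < 1 -> G a = F a) -> log_poly_lt m G.
Proof.
  intros (P & Q & HP & HQ & E) EG. exists P, Q. split; [exact HP|].
  split; [exact HQ|]. intros a Ha. rewrite EG; auto.
Qed.

Lemma log_poly_lt_weaken m m' F :
  (m <= m')%nat -> log_poly_lt m F -> log_poly_lt m' F.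
Proof.
  intros Hm (P & Q & HP & HQ & E). exists P, Q.
  split; [now apply poly_lt_weaken with m|]. split; [now apply poly_lt_weaken with m|].
  exact E.
Qed.

Lemma log_poly_lt_poly m P : poly_lt m P -> log_poly_lt m P.
Proof.
  intros HP. exists P, (fun _ => 0). split; [exact HP|].
  split; [apply poly_lt_0|]. intros; ring.
Qed.

Lemma log_poly_lt_mul_sqr m F :
  log_poly_lt m F -> log_poly_lt (m + 2) (fun a => a ^ 2 * F a).
Proof.
  intros (P & Q & HP & HQ & E).
  assert (S2 : forall f, poly_lt m f -> poly_lt (m + 2) (fun a => a ^ 2 * f a)).
  { intros f Hf. replace (m + 2)%nat with (S (S m)) by lia.
    apply (poly_lt_ext _ _ _
             (poly_lt_mul_affine _ 0 1 _ (poly_lt_mul_affine _ 0 1 _ Hf))).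
    intros; ring. }
  exists (fun a => a ^ 2 * P a), (fun a => a ^ 2 * Q a).
  split; [now apply S2|]. split; [now apply S2|].
  intros a Ha. rewrite E by exact Ha. ring.
Qed.

(** Existence of the integral and the form of its value are carried together. The limits depend on
    [a] so that the orbit arc, between [- a] and [a], and the half circle, with fixed angles, are
    treated alike. *)
Definition log_poly_integral (m : nat) (lo hi : R -> R) (phi : R -> R -> R) : Prop :=
  exists F, log_poly_lt m F /\
    forall a, 0 < a < 1 -> is_RInt (phi a) (lo a) (hi a) (F a).

Lemma log_poly_integral_lin m lo hi phi psi c :
  log_poly_integral m lo hi phi -> log_poly_integral m lo hi psi ->
  log_poly_integral m lo hi (fun a y => phi a y + c * psi a y).
Proof.
  intros (F & HF & IF) (G & HG & IG). exists (fun a => F a + c * G a).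
  split; [now apply log_poly_lt_lin|]. intros a Ha. apply is_RInt_lin; auto.
Qed.

Lemma log_poly_integral_ext m lo hi phi psi :
  log_poly_integral m lo hi phi ->
  (forall a y, 0 < a < 1 -> psi a y = phi a y) ->
  log_poly_integral m lo hi psi.
Proof.
  intros (F & HF & IF) E. exists F. split; [exact HF|]. intros a Ha.
  apply (is_RInt_eq _ _ _ _ _ _ (IF a Ha)); [|reflexivity]. intros; now apply E.
Qed.

Lemma log_poly_integral_weaken m m' lo hi phi : (m <= m')%nat ->
  log_poly_integral m lo hi phi -> log_poly_integral m' lo hi phi.
Proof.
  intros Hm (F & HF & IF). exists F. split; [|exact IF].
  now apply log_poly_lt_weaken with m.
Qed.

Lemma log_poly_integral_mul_sqr m lo hi phi :
  log_poly_integral m lo hi phi ->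
  log_poly_integral (m + 2) lo hi (fun a y => a ^ 2 * phi a y).
Proof.
  intros (F & HF & IF). exists (fun a => a ^ 2 * F a).
  split; [now apply log_poly_lt_mul_sqr|]. intros a Ha.
  exact (is_RInt_scal _ _ _ (a ^ 2) _ (IF a Ha)).
Qed.

Lemma arc_integral_pow j :
  log_poly_integral (j + 2) Ropp (fun a => a) (fun _ y => y ^ j).
Proof.
  pose proof (pos_INR j) as Hj.
  exists (fun a => / (INR j + 1) * (a ^ (j + 1) + - (-1) ^ (j + 1) * a ^ (j + 1))).
  split.
  - apply log_poly_lt_poly, poly_lt_scal, poly_lt_lin;
      replace (j + 2)%nat with (S (j + 1)) by lia; apply poly_lt_pow.
  - intros a Ha.
    refine (is_RInt_eq _ _ _ _ _ _ (is_RInt_FTC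
      (fun y => / (INR j + 1) * y ^ (j + 1)) (fun y => y ^ j) (- a) a _ _) _ _).
    + intros y. auto_derive; [trivial|]. replace (j + 1)%nat with (S j) by lia.
      rewrite S_INR. simpl pred. field. lra.
    + intros y. auto_derive. trivial.
    + reflexivity.
    + cbv beta. replace (- a) with (-1 * a) by ring. rewrite Rpow_mult_distr. ring.
Qed.

Lemma poly_lt_1_minus_sqr_pow k : poly_lt (2 * k + 1) (fun a => (1 - a ^ 2) ^ k).
Proof.
  induction k as [|k IH]; [exact (poly_lt_const 0 1)|].
  replace (2 * S k + 1)%nat with (S (S (2 * k + 1))) by lia.
  exact (poly_lt_mul_1_minus_sqr _ _ IH).
Qed.

(** For even [j] the bound [j + 3] is dictated by the logarithmic coefficient, of degree [j + 2];
    for odd [j] the integral is 0 by symmetry. *)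
Lemma arc_integral_u j :
  log_poly_integral (j + 3) Ropp (fun a => a) (fun a y => arc_u a y * y ^ j).
Proof.
  destruct (Nat.Even_or_Odd j) as [[k ->]|[k ->]].
  - destruct (arc_integral_even k) as (P & c & HP & _ & H).
    exists (fun a => P a + c * (1 - a ^ 2) ^ (k + 1) * logq a). split; [|exact H].
    exists P, (fun a => c * (1 - a ^ 2) ^ (k + 1)). split; [|split].
    + now apply poly_lt_weaken with (2 * k + 2)%nat; [lia|].
    + apply poly_lt_scal, poly_lt_weaken with (2 * (k + 1) + 1)%nat; [lia|].
      apply poly_lt_1_minus_sqr_pow.
    + reflexivity.
  - exists (fun _ => 0). split; [|intros a Ha; now apply arc_integral_odd].
    apply log_poly_lt_poly, poly_lt_0.
Qed.

(* From [u^2 = 1 - a^2 + y^2] the abscissa [x = 1 - u] satisfies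
   [x^2 = 2 x - a^2 + y^2], which lowers the exponent of [x]. *)
Lemma arc_integral_dy i j :
  log_poly_integral (i + j + 2) Ropp (fun a => a)
    (fun a y => (1 - arc_u a y) ^ i * y ^ j).
Proof.
  (* The recurrence in the exponent of [x] has order two, so two consecutive exponents are carried,
     for all powers of [y] since one term raises that power by 2. *)
  enough (H : forall k,
    log_poly_integral (i + k + 2) Ropp (fun a => a)
      (fun a y => (1 - arc_u a y) ^ i * y ^ k) /\
    log_poly_integral (S i + k + 2) Ropp (fun a => a)
      (fun a y => (1 - arc_u a y) ^ S i * y ^ k)) by apply H.
  clear j. induction i as [|i IH]; intros j.
  - split.
    + apply (log_poly_integral_ext _ _ _ _ _ (arc_integral_pow j)). intros; ring.
    + apply (log_poly_integral_ext (1 + j + 2) _ _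
               (fun a y => y ^ j + -1 * (arc_u a y * y ^ j))).
      * apply log_poly_integral_lin.
        -- apply log_poly_integral_weaken with (2 := arc_integral_pow j). lia.
        -- apply log_poly_integral_weaken with (2 := arc_integral_u j). lia.
      * intros; ring.
  - split; [apply IH|].
    apply (log_poly_integral_ext (S (S i) + j + 2) _ _
      (fun a y => ((1 - arc_u a y) ^ i * y ^ (j + 2)
                   + 2 * ((1 - arc_u a y) ^ S i * y ^ j))
                  + -1 * (a ^ 2 * ((1 - arc_u a y) ^ i * y ^ j)))).
    + apply log_poly_integral_lin; [apply log_poly_integral_lin|].
      * apply log_poly_integral_weaken with (2 := proj1 (IH (j + 2)%nat)). lia.
      * apply log_poly_integral_weaken with (2 := proj2 (IH j)). lia.
      * apply log_poly_integral_weaken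
          with (2 := log_poly_integral_mul_sqr _ _ _ _ (proj1 (IH j))). lia.
    + intros a y Ha. pose proof (arc_u_sqr a y Ha) as Hs. rewrite pow_add.
      replace (a ^ 2) with (1 + y ^ 2 - arc_u a y ^ 2) by (rewrite Hs; ring).
      simpl. ring.
Qed.

(** The form [d (x^(i+1) y^j)] integrates to 0, since [x = 0] at both ends of the arc. This trades
    [x^i y^j dx] for a multiple of [x^(i+1) y^(j-1) dy] of the same total degree; for [j = 0] the
    integral is 0. *)
Lemma arc_integral_dx i j :
  log_poly_integral (i + j + 2) Ropp (fun a => a)
    (fun a y => (1 - arc_u a y) ^ i * y ^ j * - (y / arc_u a y)).
Proof.
  destruct j as [|j].
  all: pose proof (pos_INR i) as Hi.
  - exists (fun _ => 0). split; [apply log_poly_lt_poly, poly_lt_0|]. intros a Ha.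
    refine (is_RInt_eq _ _ _ _ _ _ (is_RInt_FTC
      (fun y => (1 - arc_u a y) ^ (i + 1) / (INR i + 1))
      (fun y => (1 - arc_u a y) ^ i * - (y / arc_u a y)) (- a) a _ _) _ _).
    + intros y. pose proof (arc_u_pos a y Ha). pose proof (arc_u_derive a y Ha) as Hd.
      auto_derive; [now apply arc_u_ex_derive|]. rewrite (arc_u_Derive a y Ha).
      replace (i + 1)%nat with (S i) by lia. rewrite S_INR. simpl pred.
      unfold Rminus. field. lra.
    + intros y. pose proof (arc_u_pos a y Ha).
      auto_derive. repeat split; try (now apply arc_u_ex_derive). lra.
    + intros y. ring.
    + cbv beta. rewrite arc_u_end, arc_u_start. field. lra.
  - destruct (arc_integral_dy (S i) j) as (F & HF & IF).
    exists (fun a => 0 + - ((INR j + 1) / (INR i + 1)) * F a). split.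
    + apply log_poly_lt_lin; [apply log_poly_lt_poly, poly_lt_0|].
      apply log_poly_lt_weaken with (2 := HF). lia.
    + intros a Ha.
      pose (df := fun y => (1 - arc_u a y) ^ i * y ^ S j * - (y / arc_u a y)
                + (INR j + 1) / (INR i + 1) * ((1 - arc_u a y) ^ S i * y ^ j)).
      assert (H : is_RInt df (- a) a 0).
      { refine (is_RInt_eq _ _ _ _ _ _ (is_RInt_FTC
          (fun y => (1 - arc_u a y) ^ S i / (INR i + 1) * y ^ S j) df (- a) a _ _) _ _).
        - intros y. pose proof (arc_u_pos a y Ha).
          pose proof (arc_u_derive a y Ha) as Hd.
          auto_derive; [now apply arc_u_ex_derive|].
          rewrite (arc_u_Derive a y Ha). unfold df.
          change (match i with O => 1 | S _ => INR i + 1 end) with (INR (S i)).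
          change (match j with O => 1 | S _ => INR j + 1 end) with (INR (S j)).
          rewrite !S_INR. simpl. unfold Rminus. field. lra.
        - intros y. pose proof (arc_u_pos a y Ha). unfold df.
          auto_derive. repeat split; try (now apply arc_u_ex_derive). lra.
        - reflexivity.
        - cbv beta. rewrite arc_u_end, arc_u_start. simpl. field. lra. }
      refine (is_RInt_eq _ _ _ _ _ _
                (is_RInt_lin _ _ _ _ _ _ (- ((INR j + 1) / (INR i + 1))) H (IF a Ha)) _ _).
      * intros y. unfold df. ring.
      * reflexivity.
Qed.

(** * The half circle, and the form of [Mbar] *)

Lemma circle_integral (g : R -> R) (m d : nat) lo hi :
  (d < m)%nat -> (forall t, ex_derive g t) ->
  log_poly_integral m (fun _ => lo) (fun _ => hi) (fun a t => a ^ d * g t).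
Proof.
  intros Hd Hg. exists (fun a => RInt g lo hi * a ^ d). split.
  - apply log_poly_lt_poly, poly_lt_scal, poly_lt_weaken with (S d); [exact Hd|].
    apply poly_lt_pow.
  - intros a Ha. rewrite Rmult_comm. apply (is_RInt_scal g).
    apply (RInt_correct g), (ex_RInt_continuous g). intros t _.
    apply (ex_derive_continuous g), Hg.
Qed.

Lemma poly2_deg_le_ind n (T : (R -> R -> R) -> Prop) :
  (forall f g, T f -> T g -> T (fun x y => f x y + g x y)) ->
  (forall c i j, (i + j <= n)%nat -> T (fun x y => c * x ^ i * y ^ j)) ->
  forall f, poly2_deg_le n f -> T f.
Proof.
  intros Hplus Hmon f (c & E).
  assert (Sum : forall N (F : nat -> R -> R -> R),
    (forall i, (i <= N)%nat -> T (F i)) ->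
    T (fun x y => sum_f_R0 (fun i => F i x y) N)).
  { intros N F. induction N as [|N IH]; intros HF; simpl; [now apply HF|].
    apply Hplus; [apply IH; intros; apply HF; lia|now apply HF]. }
  (* [T] is an arbitrary predicate on functions, so pointwise equality must become equality. *)
  assert (Ef : f = fun x y => sum_f_R0 (fun i =>
              sum_f_R0 (fun j => c i j * x ^ i * y ^ j) (n - i)) n).
  { extensionality x. extensionality y. apply E. }
  rewrite Ef.
  apply (Sum n (fun i x y => sum_f_R0 (fun j => c i j * x ^ i * y ^ j) (n - i))).
  intros i Hi. apply (Sum (n - i)%nat (fun j x y => c i j * x ^ i * y ^ j)).
  intros j Hj. apply Hmon. lia.
Qed.

Lemma log_poly_integral_poly2 n lo hi (X Y w : R -> R -> R) f :
  (forall i j, (i + j <= n)%nat ->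
     log_poly_integral (n + 2) lo hi (fun a t => X a t ^ i * Y a t ^ j * w a t)) ->
  poly2_deg_le n f ->
  log_poly_integral (n + 2) lo hi (fun a t => f (X a t) (Y a t) * w a t).
Proof.
  intros H. apply (poly2_deg_le_ind n (fun f =>
    log_poly_integral (n + 2) lo hi (fun a t => f (X a t) (Y a t) * w a t))).
  - intros g k Hg Hk.
    apply (log_poly_integral_ext _ _ _ _ _ (log_poly_integral_lin _ _ _ _ _ 1 Hg Hk)).
    intros; ring.
  - intros c i j Hij.
    (* Scaling by [c] is written as [f + (c - 1) * f], to reuse the one linearity lemma. *)
    apply (log_poly_integral_ext _ _ _ _ _
             (log_poly_integral_lin _ _ _ _ _ (c - 1) (H i j Hij) (H i j Hij))).
    intros; ring.
Qed.

Lemma Derive_arc_x a y : 0 < a < 1 ->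
  Derive (fun y => 1 - sqrt (1 - a ^ 2 + y ^ 2)) y = - (y / arc_u a y).
Proof.
  intros Ha. apply is_derive_unique.
  replace (- (y / arc_u a y)) with (0 - y / arc_u a y) by ring.
  apply (is_derive_minus (fun _ => 1) (arc_u a)).
  - exact (is_derive_const 1 y).
  - now apply arc_u_derive.
Qed.

Lemma sqrt_1_minus_1_minus_sqr a : 0 < a -> sqrt (1 - (1 - a ^ 2)) = a.
Proof.
  intros Ha. replace (1 - (1 - a ^ 2)) with (a ^ 2) by ring.
  apply sqrt_pow2. lra.
Qed.

Lemma Mbar_is_RInt pp qp pm qm a Ip Iq Jp Jq : 0 < a < 1 ->
  is_RInt (fun y => pp (1 - arc_u a y) y) (- a) a Ip ->
  is_RInt (fun y => qp (1 - arc_u a y) y * - (y / arc_u a y)) (- a) a Iq ->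
  is_RInt (fun t => pm (a * cos t) (a * sin t) * (a * cos t))
    (PI / 2) (3 * PI / 2) Jp ->
  is_RInt (fun t => qm (a * cos t) (a * sin t) * - (a * sin t))
    (PI / 2) (3 * PI / 2) Jq ->
  Mbar pp qp pm qm (1 - a ^ 2) = (Iq - Ip) + (Jq - Jp).
Proof.
  intros Ha HIp HIq HJp HJq. unfold Mbar, line_integral.
  rewrite sqrt_1_minus_1_minus_sqr by lra. f_equal; apply is_RInt_unique.
  - refine (is_RInt_eq _ _ _ _ _ _ (is_RInt_lin _ _ _ _ _ _ (-1) HIq HIp) _ _).
    + intros y. rewrite Derive_arc_x, Derive_id by exact Ha. unfold arc_u. ring.
    + ring.
  - refine (is_RInt_eq _ _ _ _ _ _ (is_RInt_lin _ _ _ _ _ _ (-1) HJq HJp) _ _).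
    + intros t.
      rewrite (is_derive_unique (fun t : R => a * cos t) t (- (a * sin t)))
        by (auto_derive; [trivial|ring]).
      rewrite (is_derive_unique (fun t : R => a * sin t) t (a * cos t))
        by (auto_derive; [trivial|ring]).
      ring.
    + ring.
Qed.

Lemma Mbar_log_poly n pp qp pm qm :
  poly2_deg_le n pp -> poly2_deg_le n qp -> poly2_deg_le n pm -> poly2_deg_le n qm ->
  log_poly_lt (n + 2) (fun a => Mbar pp qp pm qm (1 - a ^ 2)).
Proof.
  intros Hpp Hqp Hpm Hqm.
  assert (H1 := log_poly_integral_poly2 n Ropp (fun a => a)
    (fun a y => 1 - arc_u a y) (fun a y => y) (fun a y => 1) pp).
  assert (H2 := log_poly_integral_poly2 n Ropp (fun a => a)
    (fun a y => 1 - arc_u a y) (fun a y => y) (fun a y => - (y / arc_u a y)) qp).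
  assert (H3 := log_poly_integral_poly2 n (fun _ => PI / 2) (fun _ => 3 * PI / 2)
    (fun a t => a * cos t) (fun a t => a * sin t) (fun a t => a * cos t) pm).
  assert (H4 := log_poly_integral_poly2 n (fun _ => PI / 2) (fun _ => 3 * PI / 2)
    (fun a t => a * cos t) (fun a t => a * sin t) (fun a t => - (a * sin t)) qm).
  destruct H1 as (Ip & Vp & HIp); [|exact Hpp|].
  { intros i j Hij. apply log_poly_integral_weaken with (i + j + 2)%nat; [lia|].
    apply (log_poly_integral_ext _ _ _ _ _ (arc_integral_dy i j)). intros; ring. }
  destruct H2 as (Iq & Vq & HIq); [|exact Hqp|].
  { intros i j Hij. apply log_poly_integral_weaken with (2 := arc_integral_dx i j). lia. }
  destruct H3 as (Jp & Wp & HJp); [|exact Hpm|].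
  { intros i j Hij.
    apply (log_poly_integral_ext _ _ _ (fun a t => a ^ (i + j + 1)
             * (cos t ^ i * sin t ^ j * cos t))).
    - apply circle_integral; [lia|]. intros t. auto_derive. trivial.
    - intros a t _. rewrite !Rpow_mult_distr, !pow_add. ring. }
  destruct H4 as (Jq & Wq & HJq); [|exact Hqm|].
  { intros i j Hij.
    apply (log_poly_integral_ext _ _ _ (fun a t => a ^ (i + j + 1)
             * (cos t ^ i * sin t ^ j * - sin t))).
    - apply circle_integral; [lia|]. intros t. auto_derive. trivial.
    - intros a t _. rewrite !Rpow_mult_distr, !pow_add. ring. }
  apply (log_poly_lt_ext _ (fun a => (Iq a + -1 * Ip a) + 1 * (Jq a + -1 * Jp a))).
  - repeat apply log_poly_lt_lin; assumption.
  - intros a Ha. rewrite (Mbar_is_RInt _ _ _ _ a (Ip a) (Iq a) (Jp a) (Jq a)); auto.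
    + ring.
    + apply (is_RInt_eq _ _ _ _ _ _ (HIp a Ha)); [intros; ring|reflexivity].
Qed.

(** * Functions with many zeros *)

(** Both clauses look at functions only on the open unit interval, so functions that agree there are
    identified without a quotient. *)
Definition subspace (U : (R -> R) -> Prop) : Prop :=
  (forall f, (forall x, 0 < x < 1 -> f x = 0) -> U f) /\
  (forall f g h c, U f -> U g ->
     (forall x, 0 < x < 1 -> h x = f x + c * g x) -> U h).

(* [dim_ge m V] says that the dimension of [V] is at least [m], by means of a
   strictly increasing flag of subspaces. *)
Fixpoint dim_ge (m : nat) (V : (R -> R) -> Prop) : Prop :=
  match m with
  | O => True
  | S m => exists g U, V g /\ ~ U g /\ subspace U /\ (forall f, U f -> V f) /\
                       dim_ge m U
  end.

Lemma dim_ge_incl m (V W : (R -> R) -> Prop) :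
  (forall f, V f -> W f) -> dim_ge m V -> dim_ge m W.
Proof.
  destruct m as [|m]; simpl; [trivial|].
  intros H (g & U & Hg & HUg & HU & HUV & Hd). exists g, U. auto 10.
Qed.

Lemma subspace_vanishing V x :
  0 < x < 1 -> subspace V -> subspace (fun f => V f /\ f x = 0).
Proof.
  intros Hx [H0 H1]. split.
  - intros f Hf. auto.
  - intros f g h c [Hf Ef] [Hg Eg] E. split; [now apply (H1 f g h c)|].
    rewrite E, Ef, Eg by exact Hx. ring.
Qed.

(** If some [f] in the next subspace [U] does not vanish at [x], a multiple of it corrects [g] to
    vanish there, and the rest of the flag is cut down by induction. Otherwise [U] already vanishes
    at [x], and only the top step is lost. *)
Lemma dim_ge_vanishing m V x :
  0 < x < 1 -> subspace V -> dim_ge (S m) V ->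
  dim_ge m (fun f => V f /\ f x = 0).
Proof.
  intros Hx. revert V.
  induction m as [|m IH]; intros V HV (g & U & Hg & HUg & HU & HUV & Hd); [exact I|].
  destruct (classic (exists f, U f /\ f x <> 0)) as [(f & Hf & Hfx)|H].
  - exists (fun y => g y + - (g x / f x) * f y), (fun f => U f /\ f x = 0).
    split; [split|split; [|split; [|split]]].
    + apply ((proj2 HV) g f _ (- (g x / f x))); auto.
    + field. exact Hfx.
    + intros [H _]. apply HUg.
      apply ((proj2 HU) _ f _ (g x / f x) H Hf). intros y _. ring.
    + now apply subspace_vanishing.
    + intros k [Hk Ek]. auto.
    + now apply IH.
  - apply dim_ge_incl with (2 := Hd). intros f Hf. split; [now apply HUV|].
    apply NNPP. intros Hfx. apply H. now exists f.
Qed.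

Lemma dim_ge_interpolate (l : list R) V :
  (forall x, In x l -> 0 < x < 1) -> subspace V -> dim_ge (S (length l)) V ->
  exists f, V f /\ (forall x, In x l -> f x = 0) /\
            ~ (forall x, 0 < x < 1 -> f x = 0).
Proof.
  revert V. induction l as [|x l IH]; intros V Hl HV Hd.
  - destruct Hd as (g & U & Hg & HUg & HU & _). exists g.
    split; [exact Hg|]. split; [intros x []|]. intros H. apply HUg, (proj1 HU), H.
  - assert (Hx : 0 < x < 1) by (apply Hl; now left).
    destruct (IH (fun f => V f /\ f x = 0)) as (f & [Hf Ef] & Hfl & Hn).
    + intros y Hy. apply Hl. now right.
    + now apply subspace_vanishing.
    + now apply dim_ge_vanishing.
    + exists f. split; [exact Hf|]. split; [|exact Hn].
      intros y [<-|Hy]; auto.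
Qed.

(** * A flag of Melnikov functions *)

Lemma poly2_deg_le_lin n f g c :
  poly2_deg_le n f -> poly2_deg_le n g ->
  poly2_deg_le n (fun x y => f x y + c * g x y).
Proof.
  intros (p & Ef) (q & Eg). exists (fun i j => p i j + c * q i j). intros x y.
  rewrite Ef, Eg, scal_sum, <- sum_plus. apply sum_eq. intros i _.
  rewrite Rmult_comm, scal_sum, <- sum_plus. apply sum_eq. intros j _. ring.
Qed.

Lemma sum_f_R0_single (F : nat -> R) k N :
  (k <= N)%nat -> (forall i, i <> k -> F i = 0) -> sum_f_R0 F N = F k.
Proof.
  induction N as [|N IH]; intros Hk HF; simpl.
  - now replace k with 0%nat by lia.
  - destruct (Nat.eq_dec k (S N)) as [->|Hn].
    + rewrite sum_eq_R0 by (intros i Hi; apply HF; lia). ring.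
    + rewrite IH, (HF (S N)) by (lia || exact HF || congruence). ring.
Qed.

Lemma poly2_deg_le_monomial n i j :
  (i + j <= n)%nat -> poly2_deg_le n (fun x y => x ^ i * y ^ j).
Proof.
  intros Hij.
  exists (fun i' j' => if Nat.eq_dec i' i then if Nat.eq_dec j' j then 1 else 0 else 0).
  intros x y. rewrite (sum_f_R0_single _ i); [|lia|].
  - rewrite (sum_f_R0_single _ j); [|lia|].
    + destruct (Nat.eq_dec i i), (Nat.eq_dec j j); try congruence. ring.
    + intros j' Hj'. destruct (Nat.eq_dec i i), (Nat.eq_dec j' j); try congruence; ring.
  - intros i' Hi'. apply sum_eq_R0. intros j' _.
    destruct (Nat.eq_dec i' i); [congruence|ring].
Qed.

Lemma poly2_deg_le_0 n : poly2_deg_le n (fun _ _ => 0).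
Proof.
  exists (fun _ _ => 0). intros x y. symmetry. apply sum_eq_R0. intros i _.
  apply sum_eq_R0. intros j _. ring.
Qed.

Lemma poly2_deg_le_scal n c f :
  poly2_deg_le n f -> poly2_deg_le n (fun x y => c * f x y).
Proof.
  intros Hf. destruct (poly2_deg_le_lin n _ f c (poly2_deg_le_0 n) Hf) as (p & E).
  exists p. intros x y. rewrite <- E. ring.
Qed.

(* The Melnikov functions, up to sign and in the variable [a = sqrt (1 - h)],
   obtained for [q+ = q- = 0]. *)
Definition realizable (n : nat) (F : R -> R) : Prop :=
  exists pp pm I J, poly2_deg_le n pp /\ poly2_deg_le n pm /\
    forall a, 0 < a < 1 ->
      is_RInt (fun y => pp (1 - arc_u a y) y) (- a) a (I a) /\
      is_RInt (fun t => pm (a * cos t) (a * sin t) * (a * cos t))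
        (PI / 2) (3 * PI / 2) (J a) /\
      F a = I a + J a.

Lemma is_RInt_0 (a b : R) : is_RInt (fun _ => 0) a b 0.
Proof.
  pose proof (is_RInt_const a b 0) as H.
  unfold scal in H; simpl in H; unfold mult in H; simpl in H.
  now rewrite Rmult_0_r in H.
Qed.

Lemma realizable_subspace n : subspace (realizable n).
Proof.
  split.
  - intros f Hf. exists (fun _ _ => 0), (fun _ _ => 0), (fun _ => 0), (fun _ => 0).
    split; [apply poly2_deg_le_0|]. split; [apply poly2_deg_le_0|].
    intros a Ha. split; [apply is_RInt_0|]. split.
    + apply (is_RInt_eq _ _ _ _ _ _ (is_RInt_0 _ _)); [intros; ring|reflexivity].
    + rewrite Hf by exact Ha. ring.
  - intros f g h c (pp & pm & I & J & Hpp & Hpm & H)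
      (pp' & pm' & I' & J' & Hpp' & Hpm' & H') E.
    exists (fun x y => pp x y + c * pp' x y), (fun x y => pm x y + c * pm' x y),
      (fun a => I a + c * I' a), (fun a => J a + c * J' a).
    split; [now apply poly2_deg_le_lin|]. split; [now apply poly2_deg_le_lin|].
    intros a Ha. destruct (H a Ha) as (HI & HJ & Ef), (H' a Ha) as (HI' & HJ' & Eg).
    split; [now apply is_RInt_lin|]. split.
    + apply (is_RInt_eq _ _ _ _ _ _ (is_RInt_lin _ _ _ _ _ _ c HJ HJ'));
        [intros; ring|reflexivity].
    + rewrite E, Ef, Eg by exact Ha. ring.
Qed.

Lemma realizable_pow n d : (d <= n)%nat -> realizable n (fun a => a ^ (d + 1)).
Proof.
  intros Hd.
  assert (Cont : forall t, continuous (fun t => (- cos t) ^ (d + 1)) t).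
  { intros t. apply (ex_derive_continuous (fun t => (- cos t) ^ (d + 1))).
    auto_derive. trivial. }
  (* On the left half circle [- cos t] is positive, so this normalizing constant is nonzero for
     every parity of [d]; the sign [(-1) ^ (d + 1)] is put into [p-]. *)
  pose (kappa := RInt (fun t => (- cos t) ^ (d + 1)) (PI / 2) (3 * PI / 2)).
  assert (Hk : 0 < kappa).
  { pose proof PI_RGT_0. apply RInt_gt_0; [lra| |intros t _; apply Cont].
    intros t Ht. apply pow_lt. pose proof (cos_lt_0 t ltac:(lra) ltac:(lra)). lra. }
  assert (Ik : is_RInt (fun t => (- cos t) ^ (d + 1)) (PI / 2) (3 * PI / 2) kappa).
  { apply (RInt_correct (fun t => (- cos t) ^ (d + 1))), ex_RInt_continuous.
    intros t _. apply Cont. }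
  exists (fun _ _ => 0), (fun x y => (-1) ^ (d + 1) / kappa * (x ^ d * y ^ 0)),
    (fun _ => 0), (fun a => a ^ (d + 1)).
  split; [apply poly2_deg_le_0|].
  split; [apply poly2_deg_le_scal, poly2_deg_le_monomial; lia|].
  intros a Ha. split; [apply is_RInt_0|]. split; [|ring].
  refine (is_RInt_eq _ _ _ _ _ _ (is_RInt_scal _ _ _ (a ^ (d + 1) / kappa) _ Ik) _ _).
  - intros t. unfold scal; simpl; unfold mult; simpl.
    replace (- cos t) with (-1 * cos t) by ring.
    rewrite !Rpow_mult_distr, !pow_add. simpl. field. lra.
  - unfold scal; simpl; unfold mult; simpl. field. lra.
Qed.

Lemma realizable_arc n k : (2 * k + 1 <= n)%nat ->
  exists P c, poly_lt (2 * k + 2) P /\ c <> 0 /\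
    realizable n (fun a => P a + c * (1 - a ^ 2) ^ (k + 1) * logq a).
Proof.
  intros Hk. destruct (arc_integral_even k) as (P & c & HP & Hc & H).
  exists P, c. split; [exact HP|]. split; [exact Hc|].
  exists (fun x y => x ^ 0 * y ^ (2 * k) + -1 * (x ^ 1 * y ^ (2 * k))), (fun _ _ => 0),
    (fun a => P a + c * (1 - a ^ 2) ^ (k + 1) * logq a), (fun _ => 0).
  split; [apply poly2_deg_le_lin; apply poly2_deg_le_monomial; lia|].
  split; [apply poly2_deg_le_0|].
  intros a Ha. split; [|split; [|ring]].
  - apply (is_RInt_eq _ _ _ _ _ _ (H a Ha)); [intros; ring|reflexivity].
  - apply (is_RInt_eq _ _ _ _ _ _ (is_RInt_0 _ _)); [intros; ring|reflexivity].
Qed.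

(** The factor [a] reflects that the half circle contributes the powers [a ^ 1] to [a ^ (n + 1)] and
    no constant. *)
Definition realizable_poly (n i : nat) (F : R -> R) : Prop :=
  realizable n F /\ exists P, poly_lt i P /\ forall a, 0 < a < 1 -> F a = a * P a.

(** [Q] is a polynomial in [h = 1 - a ^ 2] of degree at most [k], so adjoining a function with
    logarithmic part [h ^ (k + 1)] leads exactly to stage [k + 1]. *)
Definition realizable_log (n k : nat) (F : R -> R) : Prop :=
  realizable n F /\ exists P Q, poly_lt (n + 2) P /\ poly_lt (S k) Q /\
    forall a, 0 < a < 1 -> F a = P a + Q (1 - a ^ 2) * logq a.

Lemma realizable_poly_subspace n i : subspace (realizable_poly n i).
Proof.
  destruct (realizable_subspace n) as [R0 R1]. split.
  - intros f Hf. split; [now apply R0|]. exists (fun _ => 0).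
    split; [apply poly_lt_0|]. intros a Ha. rewrite Hf by exact Ha. ring.
  - intros f g h c (Rf & P & HP & E) (Rg & P' & HP' & E') Eh.
    split; [now apply (R1 f g h c)|]. exists (fun a => P a + c * P' a).
    split; [now apply poly_lt_lin|]. intros a Ha. rewrite Eh, E, E' by exact Ha. ring.
Qed.

Lemma realizable_log_subspace n k : subspace (realizable_log n k).
Proof.
  destruct (realizable_subspace n) as [R0 R1]. split.
  - intros f Hf. split; [now apply R0|]. exists (fun _ => 0), (fun _ => 0).
    split; [apply poly_lt_0|]. split; [apply poly_lt_0|].
    intros a Ha. rewrite Hf by exact Ha. ring.
  - intros f g h c (Rf & P & Q & HP & HQ & E) (Rg & P' & Q' & HP' & HQ' & E') Eh.
    split; [now apply (R1 f g h c)|].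
    exists (fun a => P a + c * P' a), (fun a => Q a + c * Q' a).
    split; [now apply poly_lt_lin|]. split; [now apply poly_lt_lin|].
    intros a Ha. rewrite Eh, E, E' by exact Ha. ring.
Qed.

Lemma dim_ge_realizable_poly n i : (i <= n + 1)%nat -> dim_ge i (realizable_poly n i).
Proof.
  induction i as [|i IH]; intros Hi; [exact I|].
  exists (fun a => a ^ (i + 1)), (realizable_poly n i).
  split; [|split; [|split; [|split]]].
  - split; [apply realizable_pow; lia|]. exists (fun a => a ^ i).
    split; [apply poly_lt_pow|]. intros a _. rewrite pow_add. ring.
  - intros (_ & P & HP & E). apply R1_neq_R0, (poly_lt_eq_monomial i P 1 HP).
    intros a Ha. specialize (E a Ha). rewrite pow_add in E.
    apply (Rmult_eq_reg_l a); lra.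
  - apply realizable_poly_subspace.
  - intros f (Rf & P & HP & E). split; [exact Rf|]. exists P.
    split; [now apply poly_lt_S|exact E].
  - apply IH. lia.
Qed.

Lemma dim_ge_realizable_log n k :
  (2 * k <= n + 1)%nat -> dim_ge (k + (n + 1)) (realizable_log n k).
Proof.
  induction k as [|k IH]; intros Hk.
  - apply dim_ge_incl with (2 := dim_ge_realizable_poly n (n + 1) (le_n _)).
    intros f (Rf & P & HP & E). split; [exact Rf|].
    exists (fun a => a * P a), (fun _ => 0).
    split; [|split; [apply poly_lt_0|]].
    + replace (n + 2)%nat with (S (n + 1)) by lia. now apply poly_lt_mul_x.
    + intros a Ha. rewrite E by exact Ha. ring.
  - destruct (realizable_arc n k) as (P & c & HP & Hc & HR); [lia|].
    exists (fun a => P a + c * (1 - a ^ 2) ^ (k + 1) * logq a), (realizable_log n k).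
    split; [|split; [|split; [|split]]].
    + split; [exact HR|]. exists P, (fun h => c * h ^ (k + 1)).
      split; [|split; [|reflexivity]].
      * apply poly_lt_weaken with (2 := HP). lia.
      * replace (S (S k)) with (S (k + 1)) by lia. apply poly_lt_scal, poly_lt_pow.
    + intros (_ & P' & Q & HP' & HQ & E). apply Hc.
      apply (poly_lt_eq_monomial (k + 1) Q c).
      { now replace (k + 1)%nat with (S k) by lia. }
      (* If the new function already lay in stage [k], comparing the coefficients of the logarithm
         would make [c h^(k+1)] a polynomial in [h] of degree at most [k]. The first argument is
         merely a common degree bound. *)
      assert (Z : forall x, c * (1 - x ^ 2) ^ (k + 1) + -1 * Q (1 - x ^ 2) = 0).
      { apply (poly_logq_independent (n + 2 * (k + 1) + 2) (fun a => P a + -1 * P' a)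
                 (fun x => c * (1 - x ^ 2) ^ (k + 1) + -1 * Q (1 - x ^ 2))).
        - apply poly_lt_lin.
          + apply poly_lt_weaken with (2 := HP). lia.
          + apply poly_lt_weaken with (2 := HP'). lia.
        - apply poly_lt_lin.
          + apply poly_lt_scal, poly_lt_weaken with (2 * (k + 1) + 1)%nat; [lia|].
            apply poly_lt_1_minus_sqr_pow.
          + apply poly_lt_weaken with (2 * S k)%nat; [lia|].
            now apply poly_lt_comp_1_minus_sqr.
        - intros a Ha. specialize (E a Ha). cbv beta in E. lra. }
      intros h Hh. specialize (Z (sqrt (1 - h))). rewrite pow2_sqrt in Z by lra.
      replace (1 - (1 - h)) with h in Z by ring. lra.
    + apply realizable_log_subspace.
    + intros f (Rf & P' & Q & HP' & HQ & E). split; [exact Rf|]. exists P', Q.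
      split; [exact HP'|]. split; [now apply poly_lt_S|exact E].
    + apply IH. lia.
Qed.

(** * The two bounds on the number of zeros *)

Lemma sqrt_1_minus_bounds h : 0 < h < 1 -> 0 < sqrt (1 - h) < 1.
Proof.
  intros Hh. split; [apply sqrt_lt_R0; lra|].
  rewrite <- sqrt_1 at 2. apply sqrt_lt_1_alt. lra.
Qed.

Lemma one_minus_sqrt_sqr h : 0 < h < 1 -> 1 - sqrt (1 - h) ^ 2 = h.
Proof. intros Hh. rewrite pow2_sqrt by lra. ring. Qed.

Lemma admissible_num_zeros n M :
  admissible n M -> exists k, num_zeros01 M k /\ (k <= 2 * n + 3)%nat.
Proof.
  intros [(pp & qp & pm & qm & Hpp & Hqp & Hpm & Hqm & EM) Hn].
  (* One zero more than [2 * n + 3] is [2 * (n + 2)], the number at which a function of type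
     [log_poly_lt (n + 2)] must vanish. *)
  destruct (finite_or_many (fun h => 0 < h < 1 /\ M h = 0) (2 * n + 3))
    as [(l & Hl & Hlen & E)|(l & Hl & Hlen & E)].
  - exists (length l). split; [|exact Hlen]. now exists l.
  - exfalso. apply Hn. subst M.
    assert (Z : forall a, 0 < a < 1 -> Mbar pp qp pm qm (1 - a ^ 2) = 0).
    { apply (log_poly_zeros (n + 2) _ (map (fun h => sqrt (1 - h)) l)
               (Mbar_log_poly n pp qp pm qm Hpp Hqp Hpm Hqm)).
      - apply (NoDup_map_inv (fun a => 1 - a ^ 2)). rewrite map_map.
        rewrite (map_ext_in _ (fun h => h)), map_id; [exact Hl|].
        intros h Hh. apply one_minus_sqrt_sqr, E, Hh.
      - intros a Ha. apply in_map_iff in Ha. destruct Ha as (h & <- & Hh).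
        destruct (E h Hh) as [Hh01 HM]. split; [now apply sqrt_1_minus_bounds|].
        now rewrite one_minus_sqrt_sqr.
      - rewrite length_map. lia. }
    intros h Hh. rewrite <- (one_minus_sqrt_sqr h Hh). apply Z.
    now apply sqrt_1_minus_bounds.
Qed.

Lemma admissible_many_zeros n :
  exists M k, admissible n M /\ num_zeros01 M k /\ (n + (n + 1) / 2 <= k)%nat.
Proof.
  pose (s := ((n + 1) / 2)%nat).
  assert (Hs : (2 * s <= n + 1)%nat) by apply Nat.Div0.mul_div_le.
  (* An arbitrary choice of [n + s] distinct points of the interval. *)
  pose (hs := map (fun i => / (INR i + 2)) (seq 0 (n + s))).
  assert (Hhs : forall h, In h hs -> 0 < h < 1).
  { intros h Hh. apply in_map_iff in Hh. destruct Hh as (i & <- & _).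
    pose proof (pos_INR i). split; [apply Rinv_0_lt_compat; lra|].
    rewrite <- Rinv_1. apply Rinv_lt_contravar; lra. }
  assert (Nhs : NoDup hs).
  { apply Injective_map_NoDup; [|apply seq_NoDup]. intros i j E.
    apply Rinv_eq_reg in E. apply INR_eq. lra. }
  pose (l := map (fun h => sqrt (1 - h)) hs).
  destruct (dim_ge_interpolate l (realizable_log n s)) as (F & [HF _] & HFl & HF0).
  - intros a Ha. apply in_map_iff in Ha. destruct Ha as (h & <- & Hh).
    apply sqrt_1_minus_bounds, Hhs, Hh.
  - apply realizable_log_subspace.
  - replace (S (length l)) with (s + (n + 1))%nat; [now apply dim_ge_realizable_log|].
    unfold l, hs. rewrite !length_map, length_seq. lia.
  - destruct HF as (pp & pm & I & J & Hpp & Hpm & H).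
    pose (M := Mbar pp (fun _ _ => 0) pm (fun _ _ => 0)).
    assert (EM : forall a, 0 < a < 1 -> M (1 - a ^ 2) = - F a).
    { intros a Ha. destruct (H a Ha) as (HI & HJ & ->).
      unfold M. rewrite (Mbar_is_RInt _ _ _ _ a (I a) 0 (J a) 0 Ha HI); [ring| |exact HJ|];
        apply (is_RInt_eq _ _ _ _ _ _ (is_RInt_0 _ _)); intros; ring. }
    assert (HM : admissible n M).
    { split.
      - exists pp, (fun _ _ => 0), pm, (fun _ _ => 0).
        repeat split; auto using poly2_deg_le_0.
      - intros Z. apply HF0. intros a Ha.
        specialize (Z (1 - a ^ 2) ltac:(nra)). rewrite EM in Z by exact Ha. lra. }
    (* [num_zeros01] demands a complete list of zeros; finiteness comes from the upper bound, and
       the list then contains the prescribed points. *)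
    destruct (admissible_num_zeros n M HM) as (k & Hk & _).
    exists M, k. split; [exact HM|]. split; [exact Hk|].
    destruct Hk as (z & Hz & <- & Ez).
    replace (n + (n + 1) / 2)%nat with (length hs)
      by (unfold hs; rewrite length_map, length_seq; reflexivity).
    apply NoDup_incl_length; [exact Nhs|]. intros h Hh. apply Ez.
    split; [now apply Hhs|]. rewrite <- (one_minus_sqrt_sqr h) by now apply Hhs.
    rewrite EM by now apply sqrt_1_minus_bounds, Hhs.
    rewrite HFl; [ring|]. now apply (in_map (fun h => sqrt (1 - h))).
Qed.

Lemma bounded_nat_max (T : nat -> Prop) k N :
  T k -> (forall i, T i -> (i <= N)%nat) ->
  exists Z, T Z /\ forall i, T i -> (i <= Z)%nat.
Proof.
  intros Hk. induction N as [|N IH]; intros HN.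
  - exists k. split; [exact Hk|]. intros i Hi. specialize (HN i Hi). lia.
  - destruct (classic (T (S N))) as [H|H]; [now exists (S N)|].
    apply IH. intros i Hi. specialize (HN i Hi).
    assert (i <> S N) by congruence. lia.
Qed.

Lemma num_zeros01_unique M k k' : num_zeros01 M k -> num_zeros01 M k' -> k = k'.
Proof.
  intros (l & Hl & <- & E) (l' & Hl' & <- & E').
  apply Nat.le_antisymm; apply NoDup_incl_length; auto; intros h Hh.
  - now apply E', E.
  - now apply E, E'.
Qed.

Theorem theorem1p3 (n : nat) (hn : (5 <= n)%nat) :
  exists Z : nat,
    is_max_num_zeros n Z /\
    (n + (n + 1) / 2 <= Z)%nat /\ (Z <= 2 * n + (n + 1) / 2)%nat.
Proof.
  assert (Bound : forall M k, admissible n M -> num_zeros01 M k -> (k <= 2 * n + 3)%nat).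
  { intros M k HM Hk. destruct (admissible_num_zeros n M HM) as (k' & Hk' & Hle).
    now rewrite (num_zeros01_unique M k k'). }
  destruct (admissible_many_zeros n) as (M0 & k0 & HM0 & Hk0 & Hlow).
  destruct (bounded_nat_max (fun k => exists M, admissible n M /\ num_zeros01 M k)
              k0 (2 * n + 3)) as (Z & HZ & Hmax).
  - now exists M0.
  - intros i (M & HM & Hi). now apply (Bound M).
  - exists Z. split; [split; [exact HZ|]|split].
    + intros M HM. destruct (admissible_num_zeros n M HM) as (k & Hk & _).
      exists k. split; [exact Hk|]. apply Hmax. now exists M.
    + apply Nat.le_trans with (1 := Hlow), Hmax. now exists M0.
    + destruct HZ as (M & HM & HkZ). pose proof (Bound M Z HM HkZ).
      (* This is where [5 <= n] enters: it lets [2 * n + 3] fit under the claimed bound. *)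
      assert (3 <= (n + 1) / 2)%nat by (apply Nat.div_le_lower_bound; lia). lia.
Qed.
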